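(* For every constant $0<\varepsilon\le 1/100$ and every sufficiently large integer $n$ the following holds. Suppose that (i) $0<p=p(n)<1$; (ii) $D$ is a directed graph with $|V(D)|=n$; (iii) $\delta^0(D)\ge\frac{10\ln n}{\varepsilon p}$; and (iv) $\mathcal P$ is a monotone increasing directed graph property which is $(D,p,\varepsilon)$-resilient. Then Maker has a winning strategy in the $(1:\lfloor\frac{\varepsilon}{20p}\rfloor)$ Maker-Breaker game $\mathcal P(D)$.
   Context: A directed graph $D$ has vertex set $V(D)$ and arc set $E(D)\subseteq\{(u,v)\in V(D)\times V(D):u\ne v\}$; $d^+(v),d^-(v)$ are the out- and in-degrees, and $\delta^0(D)=\min\{\delta^+(D),\delta^-(D)\}$ is the minimum over all vertices of all out- and in-degrees. In the $(1:b)$ game $\mathcal P(D)$, Maker and Breaker alternately claim previously unclaimed arcs of $D$, Maker one arc per turn and Breaker $b$ arcs per turn; the winning sets are the arc sets of the arc-minimal subdigraphs of $D$ having $\mathcal P$ (Maker wins iff his claimed arcs form a digraph with $\mathcal P$). $\mathcal D(D,p)$ denotes the random subdigraph of $D$ obtained by keeping each arc independently with probability $p$. For a sequence of digraphs $D=D_n$ on $n$ vertices, $p=p(n)$ and $0\le r\le1$, $\mathcal P$ is $(D,p,r)$-resilient if asymptotically almost surely (probability tending to $1$ as $n\to\infty$) the local resilience of $D'\sim\mathcal D(D,p)$ with respect to $\mathcal P$ is at least $r$, where this means that one cannot destroy $\mathcal P$ by deleting, at each vertex $v$, at most $r\cdot d^+_{D'}(v)$ out-arcs and at most $r\cdot d^-_{D'}(v)$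 in-arcs (the local resilience being the minimum $r$ for which such a deletion destroying $\mathcal P$ exists). *)

(* Defs.v *)
From HB Require Import structures.
From mathcomp Require Import all_boot all_order all_algebra.
From mathcomp Require Import all_classical all_reals all_analysis.

Set Implicit Arguments.
Unset Strict Implicit.
Unset Printing Implicit Defensive.

Import Order.TTheory GRing.Theory Num.Theory.
Import numFieldNormedType.Exports.

Local Open Scope ring_scope.

Definition loopless (V : finType) (A : {set V * V}) : bool :=
  [forall v, (v, v) \notin A].

Record digraph (V : finType) := Digraph {
  arcs : {set V * V};
  arcs_loopless : loopless arcs
}.

HB.instance Definition _ (V : finType) := [isSub for @arcs V].
HB.instance Definition _ (V : finType) := [Countable of digraph V by <:].
HB.instance Definition _ (V : finType) := [Finite of digraph V by <:].

Definition outdeg (V : finType) (A : {set V * V}) (v : V) : nat :=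
  #|[set u | (v, u) \in A]|.

Definition indeg (V : finType) (A : {set V * V}) (v : V) : nat :=
  #|[set u | (u, v) \in A]|.

(* All degrees of a digraph are smaller than #|V|, so the default value #|V|
   of the iterated minimum is never reached unless V is empty. *)
Definition min_semidegree (V : finType) (D : digraph V) : nat :=
  \big[minn/#|V|]_(v : V) minn (outdeg (arcs D) v) (indeg (arcs D) v).

Lemma delete_arcs_loopless (V : finType) (D : digraph V) (H : {set V * V}) :
  loopless (arcs D :\: H).
Proof.
apply/forallP => v; rewrite inE negb_and.
by rewrite (forallP (arcs_loopless D) v) orbT.
Qed.

Definition delete_arcs (V : finType) (D : digraph V) (H : {set V * V}) :
  digraph V := Digraph (delete_arcs_loopless D H).

Definition digraph_property := forall V : finType, digraph V -> Prop.

Definition monotone_increasing (P : digraph_property) : Prop :=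
  forall (V : finType) (G H : digraph V),
    arcs G \subset arcs H -> P V G -> P V H.

(* The probability that the random subdigraph of D, in which each arc of D is
   kept independently with probability p, satisfies Q. *)
Definition random_subdigraph_prob (R : realType) (V : finType) (D : digraph V)
    (p : R) (Q : digraph V -> Prop) : R :=
  \sum_(G : digraph V | (arcs G \subset arcs D) && `[< Q G >])
    p ^+ #|arcs G| * (1 - p) ^+ #|arcs D :\: arcs G|.

Definition destroyable (R : realType) (P : digraph_property) (V : finType)
    (G : digraph V) (r : R) : Prop :=
  exists H : {set V * V},
    [/\ H \subset arcs G,
        forall v, (outdeg H v)%:R <= r * (outdeg (arcs G) v)%:R,
        forall v, (indeg H v)%:R <= r * (indeg (arcs G) v)%:R
      & ~ P V (delete_arcs G H)].

(* The minimum is attained whenever some r in [0, 1] qualifies. When none does,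
   i.e. when even the empty digraph on V satisfies P, the value is +oo. *)
Definition local_resilience (R : realType) (P : digraph_property)
    (V : finType) (G : digraph V) : \bar R :=
  ereal_inf [set r%:E | r in [set r : R | 0 <= r <= 1 /\ destroyable P G r]].

Definition resilient (R : realType) (V : nat -> finType)
    (D : forall n, digraph (V n)) (p : nat -> R) (r : R)
    (P : digraph_property) : Prop :=
  (random_subdigraph_prob (D n) (p n)
     (fun G => (r%:E <= local_resilience R P G)%E) @[n --> \oo] --> (1 : R))%classic.

Variant player := Maker | Breaker.

Definition opponent (a : player) : player :=
  if a is Maker then Breaker else Maker.

Definition is_maker (a : player) : bool :=
  if a is Maker then true else false.

Section Game.
Variables (T : finType) (X : {set T}) (F : {set T} -> Prop).
(* F is the family of winning sets, b the bias of Breaker, and first the player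
   who makes the first move. A history lists the sets of elements claimed in the
   successive turns, in chronological order. *)
Variables (b : nat) (first : player).

Definition mover (i : nat) : player := if odd i then opponent first else first.

Definition bias (a : player) : nat := if a is Maker then 1%N else b.

Definition claimed (h : seq {set T}) : {set T} :=
  \bigcup_(i < size h) nth finset.set0 h i.

Definition maker_claimed (h : seq {set T}) : {set T} :=
  \bigcup_(i < size h | is_maker (mover i)) nth finset.set0 h i.

(* A player claims exactly as many elements as his bias, or all the remaining
   ones if there are fewer. *)
Definition legal_move (h : seq {set T}) (S : {set T}) : bool :=
  (S \subset X :\: claimed h) &&
  (#|S| == minn (bias (mover (size h))) #|X :\: claimed h|).

Definition legal_history (h : seq {set T}) : Prop :=
  forall i, (i < size h)%N -> legal_move (take i h) (nth finset.set0 h i).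

Definition follows (sigma : seq {set T} -> {set T}) (h : seq {set T}) : Prop :=
  forall i, (i < size h)%N -> is_maker (mover i) ->
    nth finset.set0 h i = sigma (take i h).

Definition maker_winning_strategy (sigma : seq {set T} -> {set T}) : Prop :=
  forall h, legal_history h -> follows sigma h ->
    (is_maker (mover (size h)) -> legal_move h (sigma h)) /\
    (claimed h = X -> exists2 W, F W & W \subset maker_claimed h).

Definition maker_wins : Prop := exists sigma, maker_winning_strategy sigma.

End Game.

Definition winning_set (P : digraph_property) (V : finType) (D : digraph V)
    (W : {set V * V}) : Prop :=
  exists G : digraph V,
    [/\ arcs G = W, arcs G \subset arcs D, P V G
      & forall G' : digraph V, arcs G' \proper arcs G -> ~ P V G'].

Definition maker_wins_property_game (P : digraph_property) (V : finType)
    (D : digraph V) (b : nat) (first : player) : Prop :=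
  maker_wins (arcs D) (winning_set P D) b first.

(* Main.v *)
Require Import Defs.
From HB Require Import structures.
From mathcomp Require Import all_boot all_order all_algebra.
From mathcomp Require Import all_classical all_reals all_analysis.
From mathcomp Require Import fintype finset ring lra.

Set Implicit Arguments.
Unset Strict Implicit.
Unset Printing Implicit Defensive.

Import Order.TTheory GRing.Theory Num.Theory.

Local Open Scope ring_scope.

(** Maker exposes the arcs of [D] one by one, as if tossing for each of them a
    coin of bias [p], and claims every successful arc that is still free. His
    coins are derandomised: after each exposure he picks an outcome that keeps
    positive the conditional probability of a resilient outcome minus, summed
    over the stars, exponential potentials that bound the conditional
    probability of missing too many successes in a star. To keep Breaker's
    share of every star small until the star is fully exposed, Maker always
    exposes arcs of the star that is most dangerous in the sense of a biased
    box game, and he ends his turn with a success on a free arc. In the end the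
    successes that he missed form an admissible deletion from a resilient
    digraph, so his own arcs have the property. *)

(** * Cardinalities after adding one element *)

Section Cardinals.
Variable T : finType.
Implicit Types (a : T) (A B E : {set T}).

Lemma card_setU1I a A B :
  a \notin A -> #|(a |: A) :&: B| = ((a \in B) + #|A :&: B|)%N.
Proof.
move=> aA; rewrite setIUl.
rewrite (_ : [set a] :&: B = if a \in B then [set a] else set0); last first.
  by apply/setP => x; case: ifP => aB; rewrite !inE; case: eqP => // ->.
by case: ifP => aB; rewrite ?set0U // cardsU1 inE (negPf aA).
Qed.

Lemma card_setDU1 a B E :
  a \notin E -> #|B :\: E| = ((a \in B) + #|B :\: (a |: E)|)%N.
Proof.
move=> aE; rewrite (cardsD1 a) !inE aE /=; congr (_ + #|pred_of_set _|)%N.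
by apply/setP => x; rewrite !inE negb_or andbA.
Qed.

End Cardinals.

(** * Exposure of coins: conditional probabilities, potentials and dangers *)

Section Exposure.
Variables (R : realType) (T I : finType) (X : {set T}) (F : I -> {set T}).
Variables (good : pred {set T}) (eps p : R).
Hypotheses (eps01 : 0 < eps <= 1 / 100) (p01 : 0 < p < 1).

Implicit Types (a : T) (i : I) (B E S K : {set T}).

(** The conditional probability that a [p]-random subset of [X] is [good], given that its successes
    inside the exposed set [E] are exactly [S]. *)
Definition cond_prob E S : R :=
  \sum_(G : {set T} | [&& G \subset X, G :&: E == S & good G])
    p ^+ #|G :\: E| * (1 - p) ^+ #|X :\: (G :|: E)|.

(** Total probability over the coin of [a]: the sets [G] containing [a] give the first term, the
    others the second. *)
Lemma cond_prob_expose E S a : a \in X -> a \notin E -> S \subset E ->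
  cond_prob E S
    = p * cond_prob (a |: E) (a |: S) + (1 - p) * cond_prob (a |: E) S.
Proof.
move=> aX aE /subsetP SE.
have aS : a \notin S by apply/negP => /SE; apply/negP.
rewrite /cond_prob (bigID (fun G : {set T} => a \in G)) /= !big_distrr /=.
congr (_ + _); apply: eq_big => [G|G /andP[_ aG]].
- rewrite -!andbA; congr (_ && _); rewrite andbC -andbA andbC.
  congr (_ && _); apply/andP/eqP => [[aG /eqP GE]|GE].
    by apply/setP => x; rewrite -GE !inE; case: eqP => // ->; rewrite aG.
  have aG : a \in G by have /setP/(_ a) := GE; rewrite !inE eqxx andbT.
  split=> //; apply/eqP/setP => x; have /setP/(_ x) := GE; rewrite !inE.
  by case: eqP => // ->; rewrite (negPf aE) (negPf aS) andbF.
- rewrite (card_setDU1 _ aE) aG exprS -mulrA.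
  congr (_ * (_ * _ ^+ #|pred_of_set _|)).
  by apply/setP => x; rewrite !inE; case: eqP => // ->; rewrite aG.
- rewrite -!andbA; congr (_ && _); rewrite andbC -andbA andbC.
  congr (_ && _); apply/andP/eqP => [[aG /eqP GE]|GE].
    by apply/setP => x; rewrite -GE !inE; case: eqP => // ->; rewrite (negPf aG).
  have aG : a \notin G.
    by have /setP/(_ a) := GE; rewrite !inE eqxx andbT (negPf aS) => ->.
  split=> //; apply/eqP/setP => x; have /setP/(_ x) := GE; rewrite !inE.
  by case: eqP => // ->; rewrite (negPf aE) (negPf aS) andbF.
- rewrite (card_setDU1 _ aE) (negPf aG) add0n mulrCA.
  have aGE : a \notin G :|: E by rewrite inE negb_or aG.
  rewrite (card_setDU1 _ aGE) aX exprS.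
  by congr (_ * (_ * _ ^+ #|pred_of_set (_ :\: _)|)); rewrite setUCA.
Qed.

Lemma cond_prob_full S : cond_prob X S <= (good S)%:R.
Proof.
rewrite /cond_prob (eq_bigl (fun G => (G == S) && ((S \subset X) && good S))).
  rewrite big_mkcondr /= big_pred1_eq.
  case: ifP => [/andP[SX ->]|_]; last by case: (good S).
  rewrite (setUidPr SX) setDv cards0 (_ : S :\: X = set0).
    by rewrite cards0 !expr0 mul1r.
  by apply/eqP; rewrite setD_eq0.
move=> G; apply/and3P/and3P => [[GX /eqP GS gG]|[/eqP-> SX gS]].
  by rewrite -{}GS (setIidPl GX).
by split=> //; rewrite (setIidPl SX).
Qed.

(* Potential for the event that the missed successes [S :&: K] in the box [F i]
   exceed a constant fraction of [eps] times the successes in [F i]. The base of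
   each factor makes the expected potential nonincreasing under exposure:
   [1 - p * eps / 2] is the mean of [(1 - eps / 2) ^+ c] for a coin [c] of bias
   [p], and [1 + 3 * p] bounds the extra cost of a coin weighted by [4]. *)
Definition loss E S K i : R :=
  4 ^+ #|S :&: (K :&: F i)| * (1 - eps / 2) ^+ #|S :&: F i|
    * (1 - p * eps / 2) ^+ #|F i :\: E| / (1 + 3 * p) ^+ #|K :&: F i|.

Lemma loss_gt0 E S K i : 0 < loss E S K i.
Proof.
move: eps01 p01 => /andP[e0 e1] /andP[p0 p1].
by rewrite /loss divr_gt0 ?mulr_gt0 ?exprn_gt0 //; nra.
Qed.

Lemma loss_expose E S K K' B i a : a \notin E -> S \subset E -> K \subset E ->
  K' = (if a \in B then a |: K else K) ->
  p * loss (a |: E) (a |: S) K' i + (1 - p) * loss (a |: E) S K' i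
    <= loss E S K i.
Proof.
move: eps01 p01 => /andP[e0 e1] /andP[p0 p1] aE /subsetP SE /subsetP KE K'E.
have aS : a \notin S by apply/negP => /SE; apply/negP.
have aK : a \notin K by apply/negP => /KE; apply/negP.
have SK' : S :&: (K' :&: F i) = S :&: (K :&: F i).
  apply/setP => x; rewrite K'E; case: ifP => // _; rewrite !inE.
  by case: eqP => // ->; rewrite (negPf aS).
have cK' : #|K' :&: F i| = (((a \in B) && (a \in F i)) + #|K :&: F i|)%N.
  by rewrite K'E; case: ifP => // _; rewrite card_setU1I.
have aK' : (a \in K' :&: F i) = (a \in B) && (a \in F i).
  by rewrite K'E inE; case: ifP => _; rewrite ?setU11 // (negPf aK).
have lossE (s : {set T}) : loss (a |: E) s K' i = 4 ^+ #|s :&: (K' :&: F i)|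
    * (1 - eps / 2) ^+ #|s :&: F i| * (1 - p * eps / 2) ^+ #|F i :\: (a |: E)|
    / ((1 + 3 * p) ^+ ((a \in B) && (a \in F i)) * (1 + 3 * p) ^+ #|K :&: F i|).
  by rewrite /loss cK' exprD.
rewrite !lossE /loss !card_setU1I // SK' aK' (card_setDU1 _ aE) !exprD.
set x4 := 4 ^+ #|_|; set xb := (1 - eps / 2) ^+ #|_|.
set xu := (1 - p * eps / 2) ^+ #|_|; set xk := (1 + 3 * p) ^+ #|_|.
have x40 : 0 < x4 by rewrite exprn_gt0.
have xb0 : 0 < xb by rewrite exprn_gt0 //; nra.
have xu0 : 0 < xu by rewrite exprn_gt0 //; nra.
have xk0 : 0 < xk by rewrite exprn_gt0 //; nra.
have Y0 : 0 < x4 * xb * xu / xk by rewrite divr_gt0 ?mulr_gt0.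
have p3 : 1 + 3 * p != 0 by apply: lt0r_neq0; nra.
have xk' : xk != 0 by rewrite gt_eqF.
case: (a \in F i); case: (a \in B) => /=; rewrite ?expr0 ?expr1 ?mul1r.
- rewrite [leLHS](_ : _ = (x4 * xb * xu / xk) *
      ((p * (4 * (1 - eps / 2)) + (1 - p)) / (1 + 3 * p))); last first.
    by field; apply/andP; split.
  rewrite [leRHS](_ : _ = (x4 * xb * xu / xk) * (1 - p * eps / 2)); last by field.
  (* After clearing [1 + 3 * p] the two sides differ by [3 / 2] times this product; in the other
     three cases equality holds. *)
  have pe0 : 0 < p * eps * (1 - p) by rewrite !mulr_gt0 // subr_gt0.
  by rewrite ler_pM2l // ler_pdivrMr; nra.
- rewrite [leLHS](_ : _ = (x4 * xb * xu / xk) * (1 - p * eps / 2)); last by field.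
  by rewrite le_eqVlt; apply/orP; left; apply/eqP; field.
- by rewrite le_eqVlt; apply/orP; left; apply/eqP; field.
- by rewrite le_eqVlt; apply/orP; left; apply/eqP; field.
Qed.

(** The weight [2 * #|I|] equals the danger bound in [sound]; the two logarithms offset each other
    in [sound_full]. *)
Definition score E S K : R :=
  cond_prob E S - \sum_i 2 * #|I|%:R * loss E S K i.

(** Method of conditional expectations: the mean of the two new scores over the coin of [a] is at
    least the old score, so one of them is positive. *)
Lemma score_expose E S K K' B a :
  a \in X -> a \notin E -> S \subset E -> K \subset E ->
  K' = (if a \in B then a |: K else K) -> 0 < score E S K ->
  0 < score (a |: E) (a |: S) K' \/ 0 < score (a |: E) S K'.
Proof.
move=> aX aE SE KE K'E sc0; case/andP: p01 => p0 p1.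
suff : 0 < p * score (a |: E) (a |: S) K' + (1 - p) * score (a |: E) S K'.
  case: (ltP 0 (score (a |: E) (a |: S) K')) => [|le1]; first by left.
  case: (ltP 0 (score (a |: E) S K')) => [|le2]; first by right.
  by nra.
apply: lt_le_trans sc0 _; rewrite /score (cond_prob_expose aX aE SE).
rewrite !mulrBr addrACA lerD2l -opprD lerN2 !big_distrr -big_split /=.
apply: ler_sum => i _.
rewrite [p * _]mulrCA [(1 - p) * _]mulrCA -mulrDr ler_wpM2l ?mulr_ge0 //.
exact: loss_expose K'E.
Qed.

(* With bias at most [eps / (20 * p)] and every element in at most two boxes,
   one turn of Breaker raises the exponents by [1 / 2] in total, whereas a success
   lowers the exponent of its box by [1]. *)
Definition danger B S i : R :=
  expR (5 * p / eps * #|B :&: F i|%:R - #|S :&: F i|%:R).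

Definition active E i := ~~ (F i \subset E).

Definition total_danger B E S : R := \sum_(i | active E i) danger B S i.

Lemma danger_rate_ge0 : 0 <= 5 * p / eps.
Proof.
case/andP: p01 => /ltW p0 _; case/andP: eps01 => /ltW e0 _.
by rewrite divr_ge0 ?mulr_ge0.
Qed.

Lemma le_danger B B' S S' i :
  B \subset B' -> S' \subset S -> danger B S i <= danger B' S' i.
Proof.
move=> BB' SS'.
rewrite ler_expR lerB // ?ler_nat ?subset_leq_card ?setSI //.
by rewrite ler_wpM2l ?danger_rate_ge0 // ler_nat subset_leq_card ?setSI.
Qed.

(* [K] collects the elements that were exposed while belonging to Breaker:
   they are the only successes that Maker misses. *)
Record sound M B E S K : Prop := Sound {
  sound_EX : E \subset X;
  sound_SE : S \subset E;
  sound_KE : K \subset E;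
  sound_KB : K \subset B;
  sound_SM : S \subset M :|: K;
  sound_score : 0 < score E S K;
  sound_danger : forall i, danger K S i <= 2 * #|I|%:R }.

(** This bound holds at the start, where every danger is [1], and Maker restores it by the end of
    each of his turns. *)
Definition calm B E S : Prop := total_danger B E S <= #|I|%:R.

(* What remains of [calm] after a turn of Breaker: the box [v] of largest danger
   absorbs the increase. *)
Definition focused B E S : Prop :=
  exists2 v, active E v & total_danger B E S <= #|I|%:R + danger B S v / 2.

(** The total contains the danger of [v] in full while the bound grants only half of it, which
    forces [danger B S v / 2 <= #|I|]; any other active box fits into what remains. *)
Lemma focused_danger B E S i :
  focused B E S -> active E i -> danger B S i <= 2 * #|I|%:R.
Proof.
move=> [v Ev]; rewrite /total_danger => tot Ei.
have d0 j : 0 <= danger B S j by rewrite expR_ge0.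
have [iv|iv] := eqVneq i v.
  rewrite iv; have : danger B S v <= #|I|%:R + danger B S v / 2.
    by apply: le_trans tot; rewrite (bigD1 v) //= lerDl sumr_ge0.
  by lra.
have : danger B S v + danger B S i <= #|I|%:R + danger B S v / 2.
  apply: le_trans tot; rewrite (bigD1 v) //= (bigD1 i) ?Ei //= addrA lerDl.
  by rewrite sumr_ge0.
by have := d0 v; have : (0 : R) <= #|I|%:R by []; lra.
Qed.

Lemma sub_total_danger B E E' S :
  E \subset E' -> total_danger B E' S <= total_danger B E S.
Proof.
move=> EE'; rewrite /total_danger [leLHS]big_mkcond [leRHS]big_mkcond /=.
apply: ler_sum => i _; rewrite /active; case: ifP => [nE'|_].
  by rewrite ifT //; apply: contra nE' => /subset_trans; apply.
by case: ifP; rewrite ?expR_ge0.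
Qed.

(** A success divides the danger of [v] by [expR 1 >= 2], which pays for the excess; no other danger
    grows. *)
Lemma calm_expose_success B E S v a : active E v -> a \in F v -> a \notin S ->
  total_danger B E S <= #|I|%:R + danger B S v / 2 ->
  calm B (a |: E) (a |: S).
Proof.
move=> Ev av aS tot.
apply: le_trans (sub_total_danger _ _ (subsetUr [set a] E)) _.
have half : danger B (a |: S) v <= danger B S v / 2.
  rewrite /danger card_setU1I // av natrD opprD [- _ + _]addrC addrA expRD.
  rewrite ler_wpM2l ?expR_ge0 // expRN lef_pV2 ?posrE ?expR_gt0 //.
  by have := expR_ge1Dx (1 : R); lra.
have le_others : \sum_(i | active E i && (i != v)) danger B (a |: S) i
    <= \sum_(i | active E i && (i != v)) danger B S i.
  by apply: ler_sum => i _; rewrite le_danger ?subsetUr.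
move: tot; rewrite /total_danger (bigD1 v) //= => tot.
by rewrite (bigD1 v) //=; lra.
Qed.

(** Once [v] is fully exposed its whole danger leaves the sum, more than the excess. *)
Lemma calm_deactivate B E E' S v : active E v -> ~~ active E' v ->
  E \subset E' -> total_danger B E S <= #|I|%:R + danger B S v / 2 ->
  calm B E' S.
Proof.
move=> Ev E'v EE' tot.
suff : total_danger B E' S <= total_danger B E S - danger B S v.
  have : 0 <= danger B S v by rewrite expR_ge0.
  by rewrite /calm; lra.
rewrite /total_danger [X in _ <= X - _](bigD1 v) //= addrC addrK.
rewrite [leLHS]big_mkcond [leRHS]big_mkcond /=; apply: ler_sum => i _.
case: ifP => [E'i|_]; last by case: ifP; rewrite ?expR_ge0.
rewrite ifT //; apply/andP; split.
  by apply: contra E'i => /subset_trans; apply.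
by apply: contraNneq E'v => <-.
Qed.

(** In boxes containing [a] the danger with respect to [K'] is bounded by that with respect to [B],
    as [K'] lies in [B]; in all other boxes [K] does not change. *)
Lemma sound_expose M M' B E S S' K K' a : sound M B E S K ->
  a \in X -> a \notin E -> K' = (if a \in B then a |: K else K) ->
  (forall i, a \in F i -> danger B S i <= 2 * #|I|%:R) ->
  S \subset S' -> S' \subset a |: S -> S' \subset M' :|: K' ->
  0 < score (a |: E) S' K' -> sound M' B (a |: E) S' K'.
Proof.
case=> EX SE KE KB SM _ KD aX aE K'E aD SS' S'S S'M sc.
have K'B : K' \subset B.
  by rewrite K'E; case: ifP => // aB; rewrite subUset sub1set aB.
split=> //.
- by rewrite subUset sub1set aX.
- by apply: subset_trans S'S _; rewrite setUS.
- by rewrite K'E; case: ifP => _; rewrite ?setUS // (subset_trans KE) ?subsetUr.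
move=> i; case aF: (a \in F i).
  exact: le_trans (le_danger _ K'B SS') (aD i aF).
have <- : danger K S' i = danger K' S' i.
  rewrite /danger K'E; case: ifP => // _.
  rewrite (_ : (a |: K) :&: F i = K :&: F i) //.
  by apply/setP => x; rewrite !inE; case: eqP => // ->; rewrite aF !andbF.
exact: le_trans (le_danger _ (subxx _) SS') (KD i).
Qed.

(** * The turns of the two players and the position after full exposure *)

Hypotheses (subFX : forall i, F i \subset X).
Hypotheses (coverF : forall x, x \in X -> exists i, x \in F i).

(** Induction on the number of unexposed elements, always exposing an element of the focus [v]. A
    failure keeps the focus or exhausts [v]; a success restores [calm] and ends the turn if its
    element is free. The second alternative arises when everything gets exposed first. *)
Lemma maker_turn M B E S K : sound M B E S K -> calm B E S \/ focused B E S ->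
  (exists2 a, a \in X :\: (M :|: B) &
    exists E' S' K', sound (a |: M) B E' S' K' /\ calm B E' S')
  \/ exists S' K', sound M B X S' K'.
Proof.
have [n] := ubnP #|X :\: E|; elim: n E S K => // n IHn E S K ltn sd cf.
have [EX|/subsetPn[x xX xE]] := boolP (X \subset E).
  right; exists S, K; rewrite (_ : X = E) //; apply/eqP.
  by rewrite eqEsubset EX (sound_EX sd).
have {cf} foc : focused B E S.
  case: cf => // ca; have [i xi] := coverF xX.
  (* A calm position is focused on any active box, since dangers are nonnegative. *)
  exists i; first by apply/subsetPn; exists x.
  by apply: le_trans ca _; rewrite lerDl divr_ge0 ?expR_ge0.
have [v Ev tot] := foc; case/subsetPn: (Ev) => a av aE.
have aX : a \in X := subsetP (subFX v) _ av.
have aS : a \notin S by apply: contra aE; apply/subsetP/(sound_SE sd).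
have aD i : a \in F i -> danger B S i <= 2 * #|I|%:R.
  by move=> ai; apply: focused_danger foc _; apply/subsetPn; exists a.
have ltn' : (#|X :\: (a |: E)| < n)%N.
  by move: ltn; rewrite (card_setDU1 _ aE) aX.
pose K' := if a \in B then a |: K else K.
have KK' : K \subset K' by rewrite /K'; case: ifP => _; rewrite ?subsetUr.
have SM' : S \subset M :|: K' by rewrite (subset_trans (sound_SM sd)) ?setUS.
case: (score_expose aX aE (sound_SE sd) (sound_KE sd) (erefl K') (sound_score sd)).
- move=> sc; have ca := calm_expose_success Ev av aS tot.
  (* A success on a claimed element costs no move: it lies in [M], or in [B] and is then recorded in
     [K']. The exposure goes on. *)
  case: (boolP (a \in M :|: B)) => [|aMB].
    rewrite inE => aMB; apply: (IHn (a |: E) (a |: S) K') => //; last by left.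
    apply: sound_expose sd aX aE (erefl _) aD (subsetUr _ _) (subxx _) _ sc.
    rewrite subUset SM' andbT sub1set inE /K'.
    by case/orP: aMB => ->; rewrite ?setU11 ?orbT.
  left; exists a; first by rewrite in_setD aMB.
  exists (a |: E), (a |: S), K'; split=> //.
  apply: sound_expose sd aX aE (erefl _) aD (subsetUr _ _) (subxx _) _ sc.
  by rewrite -setUA setUS.
- move=> sc; apply: (IHn (a |: E) S K') => //.
    exact: sound_expose sd aX aE (erefl _) aD (subxx _) (subsetUr _ _) SM' sc.
  have EE' := subsetUr [set a] E.
  have [E'v|E'v] := boolP (active (a |: E) v); last first.
    by left; apply: calm_deactivate Ev E'v EE' tot.
  by right; exists v => //; apply: le_trans (sub_total_danger _ _ EE') tot.
Qed.

Hypothesis degF : forall x, (\sum_i (x \in F i) <= 2)%N.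

Lemma sum_card_boxes (A : {set T}) : (\sum_i #|A :&: F i| <= 2 * #|A|)%N.
Proof.
rewrite (eq_bigr (fun i => \sum_(x in A) (x \in F i))%N); last first.
  move=> i _; rewrite -sum1_card [LHS]big_mkcond [RHS]big_mkcond /=.
  by apply: eq_bigr => x _; rewrite inE; case: (x \in A); case: (x \in F i).
rewrite exchange_big /= mulnC -sum_nat_const.
exact: leq_sum.
Qed.

(** The focus is an active box of largest danger [w] after the turn. Each active danger grows by at
    most [inc i * w], and the increments sum to at most [5 * p / eps * (2 * (eps / (20 * p))) = 1 /
    2]. *)
Lemma breaker_turn M B E S K B' : sound M B E S K -> calm B E S ->
  #|B'|%:R <= eps / (20 * p) ->
  sound M (B :|: B') E S K /\ (calm (B :|: B') E S \/ focused (B :|: B') E S).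
Proof.
case/andP: p01 => p0 p1; case/andP: eps01 => e0 e1.
case=> EX SE KE KB SM sc KD ca cB'.
split; first by split=> //; rewrite (subset_trans KB) ?subsetUl.
case: (pickP (active E)) => [v0 Ev0|none]; last first.
  by left; rewrite /calm /total_danger big_pred0.
right; pose v := [arg max_(i > v0 | active E i) danger (B :|: B') S i]%O.
have [Ev vmax] : active E v /\
    forall i, active E i -> danger (B :|: B') S i <= danger (B :|: B') S v.
  by rewrite /v; case: arg_maxP.
exists v => //; set w := danger (B :|: B') S v.
pose inc i : R := 5 * p / eps * #|B' :&: F i|%:R.
have inc0 i : 0 <= inc i by rewrite mulr_ge0 ?danger_rate_ge0.
have suminc : \sum_i inc i <= 1 / 2.
  rewrite -big_distrr -natr_sum /=.
  apply: (@le_trans _ _ (5 * p / eps * (2 * (eps / (20 * p))))).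
    rewrite ler_wpM2l ?danger_rate_ge0 //.
    apply: (@le_trans _ _ (2 * #|B'|%:R)).
      by rewrite -natrM ler_nat sum_card_boxes.
    by rewrite ler_wpM2l.
  rewrite le_eqVlt; apply/orP; left; apply/eqP.
  by field; rewrite ?gt_eqF.
have step i : active E i ->
    danger (B :|: B') S i <= danger B S i + inc i * w.
  move=> Ei; have := vmax i Ei; set w' := danger _ _ i; rewrite -/w => w'w.
  (* This uses [1 - x <= expR (- x)]; then [inc i * w'] is replaced by the larger [inc i * w]. *)
  have : w' * (1 - inc i) <= danger B S i.
    apply: (@le_trans _ _ (w' * expR (- inc i))).
      by rewrite ler_wpM2l ?expR_ge0 // (le_trans _ (expR_ge1Dx _)).
    rewrite -expRD ler_expR addrAC lerD2r /inc -mulrBr.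
    rewrite ler_wpM2l ?danger_rate_ge0 // lerBlDr -natrD ler_nat.
    by rewrite setIUl (leq_trans (leq_card_setU _ _)).
  by have := inc0 i; nra.
apply: (@le_trans _ _ (\sum_(i | active E i) (danger B S i + inc i * w))).
  exact: ler_sum.
rewrite big_split /= lerD // -big_distrl /= mulrC ler_wpM2l ?expR_ge0 //.
rewrite (le_trans _ (le_trans suminc _)) //; last by lra.
by rewrite [leLHS]big_mkcond; apply: ler_sum => i _; case: ifP.
Qed.

(** With all coins exposed, a positive score forces [good S] and makes each weighted loss less than
    [1]. Taking logarithms and bounding [#|K :&: F i|] by the danger condition limits the missed
    successes. *)
Lemma sound_full M B S K i : sound M B X S K ->
  good S /\ #|(S :\: M) :&: F i|%:R <= 19 / 20 * eps * #|S :&: F i|%:R.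
Proof.
case/andP: p01 => p0 p1; case/andP: eps01 => e0 e1.
case=> _ _ _ _ SM sc /(_ i) KD.
have loss0 j : 0 <= 2 * #|I|%:R * loss X S K j.
  by apply: mulr_ge0; [exact: mulr_ge0 | exact/ltW/loss_gt0].
have I1 : 1 <= #|I|%:R :> R by rewrite ler1n; apply/card_gt0P; exists i.
have sumlt : \sum_j 2 * #|I|%:R * loss X S K j < (good S)%:R.
  by move: sc; rewrite subr_gt0 => /lt_le_trans; apply; apply: cond_prob_full.
have gS : good S.
  by apply: contraT => gS; move: sumlt; rewrite (negPf gS) ltNge sumr_ge0.
split=> //; move: sumlt; rewrite gS /= (bigD1 i) //=.
have : 0 <= \sum_(j | j != i) 2 * #|I|%:R * loss X S K j by apply: sumr_ge0.
set rest := \sum_(j | _) _ => rest0 lt1.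
have {rest rest0 lt1} : 2 * #|I|%:R * loss X S K i < 1 by lra.
set N : R := 2 * #|I|%:R; have N2 : 2 <= N by rewrite /N; lra.
have N0 : 0 < N by lra.
rewrite /loss (_ : F i :\: X = set0); last by apply/eqP; rewrite setD_eq0.
rewrite cards0 expr0 mulr1 mulrA.
rewrite ltr_pdivrMr ?exprn_gt0 ?addr_gt0 ?mulr_gt0 // mul1r => lt_loss.
(* Every success outside [M] lies in [K]. *)
apply: (@le_trans _ _ #|S :&: (K :&: F i)|%:R).
  rewrite ler_nat subset_leq_card // setIA setSI //.
  apply/subsetP => x; rewrite !inE => /andP[xM xS]; rewrite xS /=.
  by move/subsetP/(_ x xS): SM; rewrite inE (negPf xM).
move: KD lt_loss; rewrite -/N /danger.
set f := #|S :&: (K :&: F i)|; set s := #|S :&: F i|; set k := #|K :&: F i|.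
rewrite -[X in _ <= X](lnK (x := N)) ?posrE // ler_expR => KD lt_loss.
have lnN : 0 <= ln N by rewrite ln_ge0 //; lra.
have pk : 3 * p * k%:R <= 3 / 5 * eps * s%:R + ln N.
  have -> : 3 * p * k%:R = 3 / 5 * eps * (5 * p / eps * k%:R).
    by field; rewrite gt_eqF.
  have : 3 / 5 * eps * (5 * p / eps * k%:R) <= 3 / 5 * eps * (s%:R + ln N).
    by apply: ler_wpM2l; lra.
  by nra.
(* Eighth power of [17 / 20 <= expR (- (3 / 20))], as [(17 / 20) ^+ 8 >= 1 / 4]. *)
have le4 : expR (6 / 5 : R) <= 4.
  have : (17 / 20) ^+ 8 <= expR (- (3 / 20) : R) ^+ 8.
    rewrite lerXn2r ?nnegrE ?expR_ge0 //.
    by apply: le_trans (expR_ge1Dx _); lra.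
  rewrite -expRM_natl (_ : 8 * - (3 / 20) = - (6 / 5)); last by field.
  rewrite expRN => le8; rewrite -[leRHS]invrK -[leLHS]invrK.
  rewrite lef_pV2 ?posrE ?invr_gt0 ?expR_gt0 //.
  by apply: le_trans le8; lra.
have leb : expR (- (51 / 100 * eps)) <= 1 - eps / 2.
  rewrite expRN -[leLHS]mul1r ler_pdivrMr ?expR_gt0 //.
  apply: (@le_trans _ _ ((1 - eps / 2) * (1 + 51 / 100 * eps))); first by nra.
  by rewrite ler_wpM2l ?expR_ge1Dx //; lra.
(* With [pk] the terms [ln N] cancel and [6 / 5 * f < (3 / 5 + 51 / 100) * eps * s] remains, so
   [f < 37 / 40 * eps * s]. *)
have : expR (ln N + 6 / 5 * f%:R - 51 / 100 * eps * s%:R) < expR (3 * p * k%:R).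
  apply: (@le_lt_trans _ _ (N * (4 ^+ f * (1 - eps / 2) ^+ s))).
    rewrite !expRD lnK ?posrE // -mulrA ler_wpM2l ?(ltW N0) //.
    rewrite -mulNr !expRM_natr ler_pM ?exprn_ge0 ?expR_ge0 //.
      by rewrite lerXn2r ?nnegrE ?expR_ge0.
    by rewrite lerXn2r ?nnegrE ?expR_ge0 //; lra.
  apply: lt_le_trans lt_loss _; rewrite expRM_natr.
  by rewrite lerXn2r ?nnegrE ?expR_ge0 ?expR_ge1Dx // addr_ge0 ?mulr_ge0 ?ltW.
rewrite ltr_expR => lt_exp.
have es0 : 0 <= eps * s%:R by rewrite mulr_ge0 // ltW.
by lra.
Qed.

(** With nothing exposed, the loss of box [i] is [(1 - p * eps / 2) ^+ #|F i|], so the hypothesis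
    says that the initial score is positive. *)
Lemma sound_start :
  \sum_i 2 * #|I|%:R * (1 - p * eps / 2) ^+ #|F i| < cond_prob set0 set0 ->
  sound set0 set0 set0 set0 set0 /\ calm set0 set0 set0.
Proof.
move=> lt0; have d1 i : danger set0 set0 i = 1.
  by rewrite /danger !set0I cards0 mulr0 subr0 expR0.
split; last first.
  rewrite /calm /total_danger (eq_bigr (fun=> 1)) => [|i _]; last exact: d1.
  by rewrite sumr_const ler_nat max_card.
split; rewrite ?sub0set //.
  rewrite subr_gt0 (le_lt_trans _ lt0) //; apply: ler_sum => i _.
  by rewrite /loss !set0I !cards0 setD0 !expr0 !mul1r divr1.
move=> i; rewrite d1.
have : 1 <= #|I|%:R :> R by rewrite ler1n; apply/card_gt0P; exists i.
by lra.
Qed.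

End Exposure.

(** * From an invariant of positions to a winning strategy *)

Section Positional.
Variables (T : finType) (X : {set T}) (F : {set T} -> Prop).
Variables (b : nat) (first : player).
Variable (inv : player -> {set T} -> {set T} -> Prop).

Definition union_turns (Q : pred nat) (h : seq {set T}) : {set T} :=
  \bigcup_(i < size h | Q i) nth set0 h i.

Lemma union_turns_rcons Q h A : union_turns Q (rcons h A) =
  if Q (size h) then union_turns Q h :|: A else union_turns Q h.
Proof.
rewrite /union_turns size_rcons big_mkcond big_ord_recr /=.
rewrite nth_rcons ltnn eqxx [in RHS]big_mkcond /=.
rewrite (eq_bigr (fun i : 'I_(size h) => if Q i then nth set0 h i else set0)).
  by case: ifP => // _; rewrite setU0.
by move=> i _; rewrite nth_rcons ltn_ord.
Qed.

Definition breaker_claimed h :=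
  union_turns (fun i => ~~ is_maker (mover first i)) h.

Lemma claimedE h : claimed h = maker_claimed first h :|: breaker_claimed h.
Proof.
exact: (bigID (fun i : 'I_(size h) => is_maker (mover first i))).
Qed.

(** The first argument of [inv] is the player about to move, the others are the elements held by
    Maker and by Breaker. *)
Lemma maker_wins_of_invariant :
  inv first set0 set0 ->
  (forall M B, inv Maker M B -> X :\: (M :|: B) != set0 ->
    exists2 a, a \in X :\: (M :|: B) & inv Breaker (a |: M) B) ->
  (forall M B (B' : {set T}), inv Breaker M B ->
    (#|B'| <= b)%N -> inv Maker M (B :|: B')) ->
  (forall a M B, inv a M B -> X \subset M :|: B ->
    exists2 W, F W & W \subset M) ->
  maker_wins X F b first.
Proof.
move=> inv0 invM invB invW.
pose reply h a :=
  `[< inv Breaker (a |: maker_claimed first h) (breaker_claimed h) >].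
(* The fallback [set0] is the forced move on a full board; otherwise [invM] supplies a reply. *)
pose sigma h :=
  if [pick a in X :\: claimed h | reply h a] is Some a then [set a] else set0.
(* Histories may continue with empty moves on a full board, where [invM] does not apply; the outcome
   is then kept in place of the invariant. *)
pose ok a h := inv a (maker_claimed first h) (breaker_claimed h)
  \/ X :\: claimed h = set0 /\
     exists2 W, F W & W \subset maker_claimed first h.
have sigmaP h : ok Maker h -> mover first (size h) = Maker ->
    legal_move X b first h (sigma h) /\ ok Breaker (rcons h (sigma h)).
  move=> okh turn.
  have McE A : maker_claimed first (rcons h A) = maker_claimed first h :|: A.
    have := union_turns_rcons (fun i => is_maker (mover first i)) h A.
    by rewrite turn.
  have BcE A : breaker_claimed (rcons h A) = breaker_claimed h.
    by rewrite /breaker_claimed union_turns_rcons turn.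
  have ClE A : claimed (rcons h A) = claimed h :|: A.
    by rewrite !claimedE McE BcE setUAC.
  have [free0|free] := eqVneq (X :\: claimed h) set0.
    have -> : sigma h = set0.
      by rewrite /sigma; case: pickP => // a; rewrite free0 inE.
    split; first by rewrite /legal_move sub0set cards0 free0 cards0 minn0.
    right; rewrite ClE McE !setU0; split=> //; case: okh => [iv|[]//].
    by apply: invW iv _; rewrite -claimedE -setD_eq0 free0.
  case: okh => [iv|[free0]]; last by rewrite free0 eqxx in free.
  rewrite /sigma; case: pickP => [a /andP[aX /asboolP ra]|none]; last first.
    have [|a aX ia] := invM _ _ iv; first by rewrite -claimedE.
    by move: (none a); rewrite /= claimedE aX /=; case/asboolP.
  split; last by left; rewrite McE BcE setUC.
  rewrite /legal_move sub1set aX turn cards1 /= eq_sym; apply/eqP/minn_idPl.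
  by apply/card_gt0P; exists a.
have okP h : legal_history X b first h -> follows first sigma h ->
    ok (mover first (size h)) h.
  elim/last_ind: h => [_ _|h A IHh lh fh].
    left; rewrite /maker_claimed /breaker_claimed /union_turns !big_ord0.
    by case: first inv0.
  have {}IHh : ok (mover first (size h)) h.
    apply: IHh => i ih.
      have := lh i; rewrite size_rcons nth_rcons ih => /(_ (ltnW ih)).
      by rewrite -cats1 takel_cat // ltnW.
    move=> mi; have := fh i; rewrite size_rcons nth_rcons ih => /(_ (ltnW ih) mi).
    by rewrite -cats1 takel_cat // ltnW.
  have := lh (size h); rewrite size_rcons nth_rcons ltnn eqxx => /(_ (leqnn _)).
  rewrite -cats1 take_size_cat // cats1 => /andP[AX /eqP cA].
  have := fh (size h); rewrite size_rcons nth_rcons ltnn eqxx => /(_ (leqnn _)).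
  rewrite -cats1 take_size_cat // cats1 => fA.
  have -> : mover first (size h).+1 = opponent (mover first (size h)).
    by rewrite /mover /=; case: (odd _); case: (first).
  case turn: (mover first (size h)) IHh cA fA => IHh cA fA /=.
    by rewrite (fA erefl); case: (sigmaP h IHh turn).
  have McE : maker_claimed first (rcons h A) = maker_claimed first h.
    have := union_turns_rcons (fun i => is_maker (mover first i)) h A.
    by rewrite turn.
  have BcE : breaker_claimed (rcons h A) = breaker_claimed h :|: A.
    by rewrite /breaker_claimed union_turns_rcons turn.
  case: IHh => [iv|[free0 W]].
    left; rewrite McE BcE; apply: invB => //.
    by rewrite cA /= geq_minl.
  right; rewrite !claimedE McE BcE setUA -claimedE; split=> //.
  move/eqP: free0; rewrite setD_eq0 => XA.
  by apply/eqP; rewrite setD_eq0 (subset_trans XA) ?subsetUl.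
exists sigma => h lh fh; have okh := okP h lh fh; split.
  move=> turn; apply: (proj1 (sigmaP h _ _)); last by case: mover turn.
  by case: mover turn okh.
move=> full; case: okh => [iv|[]//].
by apply: invW iv _; rewrite -claimedE full.
Qed.

End Positional.

(** * Out-stars and in-stars of a digraph as boxes *)

Section Stars.
Variables (V : finType) (D : digraph V).

(** The index [(v, true)] stands for the out-arcs at [v], and [(v, false)] for the in-arcs. *)
Definition star (i : V * bool) : {set V * V} :=
  [set a in arcs D | (if i.2 then a.1 else a.2) == i.1].

Lemma star_sub i : star i \subset arcs D.
Proof. by apply/subsetP => a; rewrite inE => /andP[]. Qed.

Lemma star_cover a : a \in arcs D -> exists i, a \in star i.
Proof. by move=> aD; exists (a.1, true); rewrite inE aD /=. Qed.

Lemma star_deg a : (\sum_i (a \in star i) <= 2)%N.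
Proof.
rewrite -(pair_bigA _ (fun v s => (a \in star (v, s)) : nat)) /=.
rewrite exchange_big big_bool /=.
have le1 (s : bool) : (\sum_v (a \in star (v, s)) <= 1)%N.
  pose u := if s then a.1 else a.2.
  rewrite (bigD1 u) //= big1 ?addn0 ?leq_b1 // => v /negPf vu.
  by rewrite inE /= -/u eq_sym vu andbF.
exact: leq_add (le1 true) (le1 false).
Qed.

Lemma outdeg_star (H : {set V * V}) v :
  H \subset arcs D -> outdeg H v = #|H :&: star (v, true)|.
Proof.
move=> /subsetP HD; rewrite /outdeg.
rewrite -(card_imset _ (_ : injective (fun u => (v, u)))); last by move=> x y [].
apply: eq_card => -[x y]; rewrite !inE /=; apply/imsetP/andP.
  by case=> u; rewrite inE => uH [-> ->]; rewrite uH (HD _ uH) eqxx.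
by case=> xyH /andP[_ /eqP xv]; exists y; rewrite ?inE -?xv.
Qed.

Lemma indeg_star (H : {set V * V}) v :
  H \subset arcs D -> indeg H v = #|H :&: star (v, false)|.
Proof.
move=> /subsetP HD; rewrite /indeg.
rewrite -(card_imset _ (_ : injective (fun u => (u, v)))); last by move=> x y [].
apply: eq_card => -[x y]; rewrite !inE /=; apply/imsetP/andP.
  by case=> u; rewrite inE => uH [-> ->]; rewrite uH (HD _ uH) eqxx.
by case=> xyH /andP[_ /eqP yv]; exists x; rewrite ?inE -?yv.
Qed.

Lemma min_semidegree_star i : (min_semidegree D <= #|star i|)%N.
Proof.
have le_min v :
    (min_semidegree D <= minn (outdeg (arcs D) v) (indeg (arcs D) v))%N.
  rewrite /min_semidegree; have : v \in index_enum V by rewrite mem_index_enum.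
  elim: (index_enum V) => // u r IHr; rewrite big_cons inE => /orP[/eqP<-|/IHr].
    exact: geq_minl.
  exact: leq_trans (geq_minr _ _).
case: i => v s; apply: leq_trans (le_min v) _.
have -> : #|star (v, s)| = #|arcs D :&: star (v, s)|.
  by rewrite (setIidPr (star_sub _)).
by case: s; rewrite -?outdeg_star -?indeg_star // ?geq_minl ?geq_minr.
Qed.

End Stars.

(** * Resilient outcomes and Maker's win on a fixed digraph *)

Section Resilience.
Variables (R : realType) (P : digraph_property) (V : finType) (D : digraph V).
Variables (eps p : R).
Hypotheses (eps01 : 0 < eps <= 1 / 100) (p01 : 0 < p < 1).

Definition resilient_set (S : {set V * V}) : bool :=
  `[< exists2 G : digraph V, arcs G = S &
        (eps%:E <= local_resilience R P G)%E >].

(** With nothing exposed the conditional probability is the plain one; a [resilient_set] carries a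
    digraph, which justifies the reindexing. *)
Lemma random_subdigraph_probE :
  random_subdigraph_prob D p (fun G => (eps%:E <= local_resilience R P G)%E)
    = cond_prob (arcs D) resilient_set p set0 set0.
Proof.
rewrite /cond_prob (reindex_omap (@arcs V) insub); last first.
  move=> S /and3P[_ _ /asboolP[G <- _]].
  by rewrite (valK G).
apply: eq_big => [G|G _]; last by rewrite setU0 setD0.
rewrite setI0 eqxx /= (valK G) eqxx andbT; congr (_ && _).
apply/asboolP/asboolP => [rG|[G' /val_inj->]//].
by exists G.
Qed.

(** A subdigraph of [G] with [P] and the fewest arcs is arc-minimal. *)
Lemma winning_subset (G : digraph V) (M : {set V * V}) :
  arcs G \subset arcs D -> arcs G \subset M -> P G ->
  exists2 W, winning_set P D W & W \subset M.
Proof.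
move=> GD GM PG.
pose Q (H : digraph V) := `[< P H >] && (arcs H \subset arcs G).
have QG : Q G by rewrite /Q subxx andbT; apply/asboolP.
case: (arg_minnP (fun H : digraph V => #|arcs H|) QG).
move=> H /andP[/asboolP PH HG] Hmin.
exists (arcs H); last exact: subset_trans HG GM.
exists H; split=> //; first exact: subset_trans HG GD.
move=> H' H'H PH'; have := Hmin H'; rewrite leqNgt proper_card // => /(_ _)/negP.
case=> //; apply/andP; split; first exact/asboolP.
exact: subset_trans (proper_sub H'H) HG.
Qed.

(** The missed successes [S :\: M] take at most the fraction [19 / 20 * eps] of each degree of the
    digraph on [S]. As this is strictly below [eps], deleting them cannot destroy [P], and what is
    left lies in [M]. *)
Lemma sound_full_wins M B S K (v : V) :
  sound (arcs D) (star D) resilient_set eps p M B (arcs D) S K ->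
  exists2 W, winning_set P D W & W \subset M.
Proof.
move=> sd; have full i := sound_full eps01 p01 (star_sub D) i sd.
case: (full (v, true)) => /asboolP[G GS rG] _.
have SD := sound_SE sd; have HD : S :\: M \subset arcs D.
  by rewrite (subset_trans _ SD) ?subsetDl.
case/andP: eps01 => e0 e1.
apply: (@winning_subset (delete_arcs G (S :\: M))).
- by rewrite /= GS (subset_trans _ SD) ?subsetDl.
- rewrite /= GS; apply/subsetP => x; rewrite !inE.
  by case: (x \in M); case: (x \in S).
apply: contrapT => nP; have : (eps%:E <= (19 / 20 * eps)%:E :> \bar R)%E.
  apply: le_trans rG _; apply: ereal_inf_lbound.
  exists (19 / 20 * eps) => //=; split; first by apply/andP; split; lra.
  exists (S :\: M); split=> //; first by rewrite GS subsetDl.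
    by move=> u; rewrite GS !(outdeg_star (D := D)) //; case: (full (u, true)).
  by move=> u; rewrite GS !(indeg_star (D := D)) //; case: (full (u, false)).
by rewrite lee_fin; lra.
Qed.

Lemma maker_wins_resilient first :
  #|V|%:R * #|V|%:R * 8 * (1 - p * eps / 2) ^+ min_semidegree D
    < random_subdigraph_prob D p
        (fun G => (eps%:E <= local_resilience R P G)%E) ->
  (0 < #|V|)%N ->
  maker_wins_property_game P D (Num.truncn (eps / (20 * p))) first.
Proof.
move=> lt_prob /card_gt0P[v _].
have [e0 e1] := andP eps01; have [p0 p1] := andP p01.
pose snd := sound (arcs D) (star D) resilient_set eps p.
pose calmD := @calm R _ _ (star D) eps p.
pose focusedD := @focused R _ _ (star D) eps p.
pose inv a M B := exists E S K, snd M B E S K /\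
  (calmD B E S \/ a = Maker /\ focusedD B E S).
apply: (maker_wins_of_invariant (inv := inv)).
- have [|sd ca] := @sound_start R _ _ (arcs D) (star D) resilient_set eps p.
  + rewrite -random_subdigraph_probE; apply: le_lt_trans lt_prob.
    (* There are [2 * #|V|] stars, each of weight [4 * #|V|]; hence the factor [8]. *)
    apply: (@le_trans _ _ (\sum_(i : V * bool)
        4 * #|V|%:R * (1 - p * eps / 2) ^+ min_semidegree D)).
      apply: ler_sum => i _; rewrite card_prod card_bool natrM.
      rewrite (_ : 2 * _ = 4 * #|V|%:R); last by ring.
      rewrite ler_wpM2l ?mulr_ge0 // ler_wiXn2l ?min_semidegree_star //; nra.
    rewrite sumr_const card_prod card_bool -[leLHS]mulr_natl natrM.
    by rewrite le_eqVlt; apply/orP; left; apply/eqP; ring.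
  + by exists set0, set0, set0; split=> //; left.
- move=> M B [E [S [K [sd cf]]]] free.
  have {}cf : calmD B E S \/ focusedD B E S by case: cf => [|[]]; [left|right].
  have := maker_turn eps01 p01 (star_sub D) (@star_cover V D) sd cf.
  case=> [[a aX [E' [S' [K' [sd' ca']]]]]|[S' [K' sd']]].
    by exists a => //; exists E', S', K'; split=> //; left.
  (* All arcs are exposed: Maker takes any free arc, and [calm] holds because no star is active. *)
  case/set0Pn: free => a aX; exists a => //; exists (arcs D), S', K'; split.
    by case: sd' => *; split=> //; rewrite -setUA subsetU // orbC; apply/orP; left.
  left; rewrite /calmD /calm /total_danger big_pred0 // => i.
  by rewrite /active star_sub.
- move=> M B B' [E [S [K [sd [ca|[]//]]]]] cB'.
  have [|sd' cf] := breaker_turn eps01 p01 (@star_deg V D) (B' := B') sd ca.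
    apply: le_trans (_ : (Num.truncn (eps / (20 * p)))%:R <= _).
      by rewrite ler_nat.
    by rewrite Num.Theory.truncn_le divr_ge0 ?mulr_ge0 ?ltW.
  by exists E, S, K; split=> //; case: cf; [left|right].
- move=> a M B [E [S [K [sd cf]]]] full.
  have {}cf : calmD B E S \/ focusedD B E S by case: cf => [|[]]; [left|right].
  (* On a full board no exposure can end on a free arc, so all arcs get exposed. *)
  have := maker_turn eps01 p01 (star_sub D) (@star_cover V D) sd cf.
  case=> [[x]|[S' [K' sd']]]; last exact: sound_full_wins sd'.
  by rewrite inE => /andP[/negP xMB /(subsetP full)].
Qed.

End Resilience.

(** * Estimates for large [n] *)

Theorem theorem4p1 (R : realType) (eps : R) (heps : 0 < eps <= 1 / 100)
    (V : nat -> finType) (D : forall n, digraph (V n)) (p : nat -> R)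
    (P : digraph_property)
    (hV : forall n, #|V n| = n)
    (hp : forall n, 0 < p n < 1)
    (hmono : monotone_increasing P)
    (hres : resilient D p eps P) :
  exists N : nat, forall n : nat, (N <= n)%N ->
    10 * ln (n%:R : R) / (eps * p n) <= (min_semidegree (D n))%:R ->
    forall first : player,
      maker_wins_property_game P (D n) (Num.truncn (eps / (20 * p n))) first.
Proof.
have [N _ probN] : (\forall n \near \oo, 1 / 2 < random_subdigraph_prob (D n)
    (p n) (fun G => (eps%:E <= local_resilience R P G)%E))%classic.
  by apply: cvgr_gt hres _ _; lra.
(* For [n >= 3] the error term [8 / n ^ 3] is at most [8 / 27 < 1 / 2]. *)
exists (maxn N 3) => n; rewrite geq_max => /andP[/probN/= prob_n n3] deg first.
have [e0 e1] := andP heps; have [p0 p1] := andP (hp n).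
apply: (maker_wins_resilient heps (hp n)); last by rewrite hV (leq_trans _ n3).
apply: le_lt_trans prob_n; rewrite hV.
have n3R : 3 <= n%:R :> R by rewrite ler_nat.
set d := min_semidegree (D n) in deg *.
(* By [1 - x <= expR (- x)] and the degree condition, the power is at most [expR (- (5 * ln n))]. *)
have : (1 - p n * eps / 2) ^+ d <= (n%:R ^+ 5)^-1.
  apply: (@le_trans _ _ (expR (- (p n * eps / 2)) ^+ d)).
    by rewrite lerXn2r ?nnegrE ?expR_ge0 ?expR_ge1Dx //; nra.
  rewrite -expRM_natr mulNr expRN lef_pV2 ?posrE ?expR_gt0 ?exprn_gt0; [|lra..].
  rewrite -[X in X ^+ 5](lnK (x := n%:R)) ?posrE; [|lra..].
  rewrite -expRM_natl ler_expR.
  move: deg; rewrite ler_pdivrMr ?mulr_gt0 //; nra.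
set x := n%:R in n3R *.
have x0 : 0 < x by lra.
move=> le5; apply: (@le_trans _ _ (x * x * 8 * (x ^+ 5)^-1)).
  by rewrite ler_wpM2l // !mulr_ge0 // ltW.
rewrite ler_pdivrMr ?exprn_gt0 //.
have : 27 <= x * x * x by nra.
by rewrite !exprS expr0; nra.
Qed.
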